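(* Let $s>0$ be a real number and let $\gamma:\widehat{G}\to(0,\infty)$ be a measurable function. Then $\mathfrak{H}^s_\gamma(G,H)\hookrightarrow S_2(H)$ (continuous embedding). Moreover, $$\|T\|_{S_2(H)}\le\|T\|_{\mathfrak{H}^s_\gamma(G,H)}\qquad\text{for all }T\in\mathfrak{H}^s_\gamma(G,H).$$
   Context: Setting. $G$ is a locally compact abelian Hausdorff group with neutral element $e$ and Pontryagin dual $\widehat{G}$; $H$ is a separable complex Hilbert space. $U:G\to U(H)$, $x\mapsto U_x$, is a (strongly continuous) irreducible unitary projective representation of $G$ on $H$: $U_xU_y=m(x,y)U_{xy}$ for all $x,y\in G$, with multiplier $m:G\times G\to\mathbb{T}$ (the unit circle), and $U_e=I$. Put $\sigma(x,y)=m(x,y)/m(y,x)$, so that $U_xU_y=\sigma(x,y)U_yU_x$. It is assumed that: $m$ is a Heisenberg multiplier, i.e. $x\mapsto\sigma(x,\cdot)$ is a topological isomorphism from $G$ onto $\widehat{G}$; $m(x,y)=m(x^{-1},y^{-1})$ for all $x,y\in G$; $U$ is square integrable, i.e. there are non-zero $\phi,\psi\in H$ with $x\mapsto\langle U_x\phi,\psi\rangle$ in $L^2(G)$; and $U$ is integrable, i.e. there is a non-zero $\psi\in H$ with $x\mapsto\langle U_x\psi,\psi\rangle$ in $L^1(G)$. One identifies $\widehat{G}$ with $G$ through $\sigma$: for $\xi=\sigma(x,\cdot)\in\widehat{G}$ one writes $U_\xi:=U_x$. Schatten classes. For $1\le p<\infty$, $S_p(H)$ is the space of compact operators on $H$ whose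 singular values are $p$-summable, with norm $\|T\|_{S_p(H)}$ equal to the $\ell^p$ norm of the singular values. $S_1(H)$ is the trace class and $S_2(H)$ the Hilbert-Schmidt class. Quantum Fourier transform. For $T\in S_1(H)$, $\mathcal{F}_U(T)(\xi)=\mathrm{tr}(TU_\xi^* )$, $\xi\in\widehat{G}$. The Haar measure $d\xi$ on $\widehat{G}$ is normalized so that the (known) Plancherel theorem holds: $\mathcal{F}_U$ extends (uniquely) from $S_1(H)$ to a unitary operator $\mathcal{F}_U:S_2(H)\to L^2(\widehat{G})$. This extension defines $\mathcal{F}_U$ on $S_2(H)$. Quantum Sobolev space. For $s>0$, $$\mathfrak{H}^s_\gamma(G,H)=\left\{T\in S_2(H) : \int_{\widehat{G}}(1+\gamma(\xi)^2)^s|\mathcal{F}_U(T)(\xi)|^2\,d\xi<\infty\right\},\quad \|T\|_{\mathfrak{H}^s_\gamma(G,H)}=\left(\int_{\widehat{G}}(1+\gamma(\xi)^2)^s|\mathcal{F}_U(T)(\xi)|^2\,d\xi\right)^{1/2}.$$ Embeddings. For Banach spaces $X,Y$, $X\hookrightarrow Y$ means $X\subset Y$ and there is a constant $C>0$ with $\|x\|_Y\le C\|x\|_X$ for all $x\in X$. *)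

(* Defs.v *)
From HB Require Import structures.
From mathcomp Require Import all_boot all_order all_algebra.
From mathcomp Require Import all_classical all_reals all_analysis.
From mathcomp Require Import complex.

Set Implicit Arguments.
Unset Strict Implicit.
Unset Printing Implicit Defensive.

Import Order.TTheory GRing.Theory Num.Theory.
Import numFieldNormedType.Exports.

Local Open Scope classical_set_scope.
Local Open Scope ring_scope.

(* R[i] is a numFieldType; its topology is the one every numFieldType carries
   as a module over itself. *)
HB.instance Definition _ (R : realType) :=
  PseudoMetricNormedZmod.copy R[i] R[i]^o.

(* The locally compact abelian group is written additively (the library's
   topologicalZmodType), so e, xy and x^-1 become 0, x + y and - x. *)

Definition is_character (R : realType) (G : topologicalZmodType)
    (f : G -> R[i]) : Prop :=
  [/\ continuous f, forall x, `|f x| = 1 & forall x y, f (x + y) = f x * f y].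

Record character (R : realType) (G : topologicalZmodType) := Character {
  chval :> G -> R[i];
  chvalP : is_character chval }.

Section character_group.
Context (R : realType) (G : topologicalZmodType).
Implicit Types f g h : character R G.

Lemma character_eqP f g : f = g <-> (forall x, f x = g x).
Proof.
split=> [->//|]; case: f => f fP; case: g => g gP /= /funext fg.
by subst g; rewrite (Prop_irrelevance fP gP).
Qed.

Lemma character_neq0 f x : f x != 0.
Proof. by rewrite -normr_eq0; case: (chvalP f) => _ -> _; rewrite oner_eq0. Qed.

Lemma is_character_one : is_character (fun _ : G => 1 : R[i]).
Proof.
split=> [||x y]; [exact: cst_continuous|by move=> x; rewrite normr1|].
by rewrite mulr1.
Qed.

Lemma is_character_mul f g : is_character (fun x => f x * g x).
Proof.
case: (chvalP f) => fc f1 fM; case: (chvalP g) => gc g1 gM; split.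
- by move=> x; apply: (@cvgM R[i]); [exact: fc|exact: gc].
- by move=> x; rewrite normrM f1 g1 mulr1.
- by move=> x y; rewrite fM gM mulrACA.
Qed.

Lemma is_character_inv f : is_character (fun x => f (- x)).
Proof.
case: (chvalP f) => fc f1 fM; split.
- move=> x; apply: continuous_comp; last exact: fc.
  exact: opp_continuous.
- by move=> x; exact: f1.
- by move=> x y; rewrite opprD fM.
Qed.

HB.instance Definition _ := gen_eqMixin (character R G).
HB.instance Definition _ := gen_choiceMixin (character R G).

Definition character_one := Character is_character_one.
Definition character_mul f g := Character (is_character_mul f g).
Definition character_inv f := Character (is_character_inv f).

Lemma character_mulA : associative character_mul.
Proof. by move=> f g h; apply/character_eqP => x /=; rewrite mulrA. Qed.

Lemma character_mulC : commutative character_mul.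
Proof. by move=> f g; apply/character_eqP => x /=; rewrite mulrC. Qed.

Lemma character_mul1 : left_id character_one character_mul.
Proof. by move=> f; apply/character_eqP => x /=; rewrite mul1r. Qed.

Lemma character_mulV : left_inverse character_one character_inv character_mul.
Proof.
move=> f; apply/character_eqP => x /=; case: (chvalP f) => _ _ fM.
rewrite -fM addNr; apply: (mulfI (character_neq0 f 0)).
by rewrite -fM addr0 mulr1.
Qed.

(* The group law of the dual (pointwise multiplication) is written + too. *)
HB.instance Definition _ := GRing.isZmodule.Build (character R G)
  character_mulA character_mulC character_mul1 character_mulV.

HB.instance Definition _ := Topological.copy (character R G)
  (@initial_topology (character R G) {compact-open, G -> R[i]}
     (@chval R G)).

End character_group.

HB.instance Definition _ (T : PreTopologicalZmodule.type) := isPointed.Build T 0.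

(* g_sigma_algebraType wants a pointed type, hence the instance above. *)
Definition borel (T : PreTopologicalZmodule.type) : Type :=
  g_sigma_algebraType (@open T).

HB.instance Definition _ (T : PreTopologicalZmodule.type) :=
  Measurable.copy (borel T) (g_sigma_algebraType (@open T)).

Definition is_haar (R : realType) (T : PreTopologicalZmodule.type)
    (mu : {measure set (borel T) -> \bar R}) : Prop :=
  [/\ (exists A : set (borel T), measurable A /\ mu A != 0%E),
      (forall K : set T, compact K -> (mu K < +oo)%E),
      (forall A : set (borel T), measurable A ->
         mu A = ereal_inf [set mu O | O in [set O : set T | open O /\ A `<=` O]]),
      (forall O : set T, open O ->
         mu O = ereal_sup [set mu K | K in [set K : set T | compact K /\ K `<=` O]])
    & (forall (x : T) (A : set (borel T)), measurable A ->
         mu [set x + y | y in A] = mu A)].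

Section Lp_spaces.
Context (R : realType) (T : PreTopologicalZmodule.type).
Variable mu : {measure set (borel T) -> \bar R}.

Definition modulus (z : R[i]) : R := complex.Re `|z|.

Definition borel_fun (f : T -> R[i]) : Prop :=
  forall O : set R[i], open O -> measurable (f @^-1` O : set (borel T)).

Definition in_Lp (n : nat) (f : T -> R[i]) : Prop :=
  borel_fun f /\ (\int[mu]_x (modulus (f x) ^+ n)%:E < +oo)%E.

Definition L2norm (f : T -> R[i]) : R :=
  Num.sqrt (fine (\int[mu]_x (modulus (f x) ^+ 2)%:E)%E).

End Lp_spaces.

Definition separable (T : topologicalType) : Prop :=
  exists2 D : set T, countable D & dense D.

(* A Hilbert space is a complete normed space whose norm comes from the inner
   product ip, linear in its first argument. *)
Section Hilbert.
Context (R : realType) (H : completeNormedModType R[i]).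
Variable ip : {dot H for Num.conj}.

Definition adjoint (T : H -> H) : H -> H :=
  xget (fun=> 0) [set S : H -> H | forall u v, ip (T u) v = ip u (S v)].

Definition unitary (V : H -> H) : Prop :=
  [/\ linear V, (forall v, exists u, V u = v)
    & forall u v, ip (V u) (V v) = ip u v].

Definition compact_operator (T : H -> H) : Prop :=
  linear T /\ precompact (T @` [set v | `|v| <= 1]).

Definition linindep n (v : 'I_n -> H) : Prop :=
  forall a : 'I_n -> R[i], \sum_i a i *: v i = 0 -> forall i, a i = 0.

Definition hdim (E : set H) : \bar R :=
  ereal_sup [set n%:R%:E | n in
    [set n | exists v : 'I_n -> H, (forall i, E (v i)) /\ linindep v]].

(* The singular values of T are the square roots of the eigenvalues of T^* T;
   the multiplicity of l is the dimension of the eigenspace of l ^+ 2. *)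
Definition singular_space (T : H -> H) (l : R) : set H :=
  [set v | adjoint T (T v) = ((l ^+ 2)%:C)%C *: v].

(* sum of the p-th powers of the nonzero singular values of T, each repeated
   according to its multiplicity *)
Definition schatten_sum (p : R) (T : H -> H) : \bar R :=
  (\esum_(l in [set l : R | (0 < l)%R])
     (hdim (singular_space T l) * (l `^ p)%:E))%E.

Definition schatten (p : R) : set (H -> H) :=
  [set T | compact_operator T /\ (schatten_sum p T < +oo)%E].

Definition schatten_norm (p : R) (T : H -> H) : R :=
  fine (schatten_sum p T) `^ p^-1.

(* Orthonormal bases are indexed by nat; in finite dimension the sequence is
   padded with zeros. *)
Definition orthonormal_basis (e : nat -> H) : Prop :=
  [/\ (forall i, ip (e i) (e i) = 1 \/ e i = 0),
      (forall i j, i != j -> ip (e i) (e j) = 0)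
    & (forall v, (forall i, ip v (e i) = 0) -> v = 0)].

Definition trace (T : H -> H) : R[i] :=
  xget 0 [set t : R[i] | forall e, orthonormal_basis e ->
    (fun n => \sum_(0 <= k < n) ip (T (e k)) (e k)) @ \oo --> t].

End Hilbert.

Section projective_representation.
Context (R : realType) (G : topologicalZmodType).
Context (H : completeNormedModType R[i]).
Variables (ip : {dot H for Num.conj}) (m : G -> G -> R[i]) (U : G -> H -> H).

Definition projective_representation : Prop :=
  [/\ (forall x, unitary ip (U x)),
      (forall x y, `|m x y| = 1),
      (forall x y v, U x (U y v) = m x y *: U (x + y) v),
      (forall v, U 0 v = v)
    & (forall v, continuous (fun x => U x v))].

Definition irreducible : Prop :=
  (exists v : H, v != 0) /\
  forall V : set H, closed V -> V 0 ->
    (forall (a : R[i]) u v, V u -> V v -> V (a *: u + v)) ->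
    (forall x v, V v -> V (U x v)) ->
    V = [set 0] \/ V = setT.

Definition sigma (x y : G) : R[i] := m x y / m y x.

Definition heisenberg : Prop :=
  exists (Phi : G -> character R G) (Psi : character R G -> G),
    [/\ (forall x y, Phi x y = sigma x y),
        {morph Phi : x y / x + y},
        cancel Phi Psi /\ cancel Psi Phi,
        continuous Phi & continuous Psi].

Definition square_integrable (nu : {measure set (borel G) -> \bar R}) : Prop :=
  exists phi psi : H,
    [/\ phi != 0, psi != 0 & in_Lp nu 2 (fun x => ip (U x phi) psi)].

Definition integrable_rep (nu : {measure set (borel G) -> \bar R}) : Prop :=
  exists2 psi : H, psi != 0 & in_Lp nu 1 (fun x => ip (U x psi) psi).

(* U_xi := U_x for xi = sigma(x, _); x is unique when m is Heisenberg. *)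
Definition U_dual (xi : character R G) : H -> H :=
  U (xget 0 [set x | forall y, xi y = sigma x y]).

Definition fourier1 (T : H -> H) (xi : character R G) : R[i] :=
  trace ip (T \o adjoint ip (U_dual xi)).

Variable mu : {measure set (borel (character R G)) -> \bar R}.

(* F is the unitary operator S_2(H) -> L^2 extending fourier1 from S_1(H);
   elements of L^2 are functions up to mu-almost everywhere equality, so F is
   determined on S_2(H) up to such equality.  The existence of F expresses that
   mu is normalized for the Plancherel theorem. *)
Definition plancherel_extension
    (F : (H -> H) -> character R G -> R[i]) : Prop :=
  [/\ (forall T, schatten ip 1 T -> {ae mu, forall xi, F T xi = fourier1 T xi}),
      (forall T, schatten ip 2 T -> in_Lp mu 2 (F T)),
      (forall (a : R[i]) S T, schatten ip 2 S -> schatten ip 2 T ->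
         {ae mu, forall xi,
            F (fun v => a *: S v + T v) xi = a * F S xi + F T xi}),
      (forall T, schatten ip 2 T -> L2norm mu (F T) = schatten_norm ip 2 T)
    & (forall f, in_Lp mu 2 f ->
         exists2 T, schatten ip 2 T & {ae mu, forall xi, F T xi = f xi})].

Variables (F : (H -> H) -> character R G -> R[i]).
Variables (s : R) (gam : character R G -> R).

Definition sobolev_integral (T : H -> H) : \bar R :=
  (\int[mu]_xi ((1 + gam xi ^+ 2) `^ s * modulus (F T xi) ^+ 2)%:E)%E.

Definition sobolev : set (H -> H) :=
  [set T | schatten ip 2 T /\ (sobolev_integral T < +oo)%E].

Definition sobolev_norm (T : H -> H) : R :=
  Num.sqrt (fine (sobolev_integral T)).

End projective_representation.

Definition embedded (R : realType) (V : Type)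
    (X : set V) (normX : V -> R) (Y : set V) (normY : V -> R) : Prop :=
  X `<=` Y /\
  exists C : R, 0 < C /\ forall x, X x -> normY x <= C * normX x.

(* Main.v *)
(* Since (1 + gamma^2)^s >= 1 and the Plancherel theorem identifies the S_2 norm of T
   with the L^2 norm of its Fourier transform, the inequality is monotonicity
   of the integral. *)

Require Import Defs.
From HB Require Import structures.
From mathcomp Require Import all_boot all_order all_algebra.
From mathcomp Require Import all_classical all_reals all_analysis.
From mathcomp Require Import complex.

Set Implicit Arguments.
Unset Strict Implicit.
Unset Printing Implicit Defensive.

Import Order.TTheory GRing.Theory Num.Theory.
Import numFieldNormedType.Exports.

Local Open Scope classical_set_scope.
Local Open Scope ring_scope.

Section integral_monotonicity.
Context d (T : measurableType d) (R : realType).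
Variable mu : {measure set T -> \bar R}.

(* No measurability is needed: the integral of a nonnegative function is
   a supremum over the simple functions below it. *)
Lemma ge0_le_integralT (f g : T -> \bar R) :
  (forall x, 0 <= f x)%E -> (forall x, f x <= g x)%E ->
  (\int[mu]_x f x <= \int[mu]_x g x)%E.
Proof.
move=> f0 fg.
have g0 x : (0 <= g x)%E by exact: le_trans (f0 x) (fg x).
rewrite !ge0_integralTE//; apply: le_ereal_sup => _ [h hf <-].
by exists h => // x; exact: le_trans (hf x) (fg x).
Qed.

End integral_monotonicity.

Lemma powR_ge1 (R : realType) (a s : R) : 1 <= a -> 0 <= s -> 1 <= a `^ s.
Proof. by move=> a1 s0; rewrite -(powRr0 a) ler_powR. Qed.

Lemma L2norm_le_sobolev_norm (R : realType) (G : topologicalZmodType)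
    (H : completeNormedModType R[i])
    (mu : {measure set (borel (character R G)) -> \bar R})
    (F : (H -> H) -> character R G -> R[i]) (s : R)
    (gam : character R G -> R) (T : H -> H) :
  0 <= s -> (sobolev_integral mu F s gam T < +oo)%E ->
  L2norm mu (F T) <= sobolev_norm mu F s gam T.
Proof.
move=> s0 Tfin; rewrite /L2norm /sobolev_norm ler_wsqrtr//.
have int_le : (\int[mu]_xi (modulus (F T xi) ^+ 2)%:E <=
    sobolev_integral mu F s gam T)%E.
  apply: ge0_le_integralT => xi; rewrite lee_fin ?sqr_ge0//.
  by rewrite ler_peMl ?sqr_ge0// powR_ge1// lerDl sqr_ge0.
have int_ge0 : (0 <= \int[mu]_xi (modulus (F T xi) ^+ 2)%:E)%E.
  by apply: integral_ge0 => xi _; rewrite lee_fin sqr_ge0.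
(* [fine] sends [+oo] to 0, so it respects the order only between finite values: [Tfin] bounds the
   Sobolev integral, and through [int_le] the smaller one. *)
apply: fine_le => //; rewrite ge0_fin_numE//; last exact: le_trans int_ge0 int_le.
exact: le_lt_trans int_le Tfin.
Qed.

Theorem theorem3p5 (R : realType)
  (G : topologicalZmodType)
  (G_hausdorff : hausdorff_space G)
  (G_locally_compact : locally_compact [set: G])
  (H : completeNormedModType R[i])
  (ip : {dot H for Num.conj})
  (ip_norm : forall v : H, ip v v = `|v| ^+ 2)
  (H_separable : separable H)
  (m : G -> G -> R[i]) (U : G -> H -> H)
  (U_representation : projective_representation ip m U)
  (U_irreducible : irreducible U)
  (m_heisenberg : heisenberg m)
  (m_even : forall x y : G, m x y = m (- x) (- y))
  (nu : {measure set (borel G) -> \bar R})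
  (nu_haar : is_haar nu)
  (U_square_integrable : square_integrable ip U nu)
  (U_integrable : integrable_rep ip U nu)
  (mu : {measure set (borel (character R G)) -> \bar R})
  (mu_haar : is_haar mu)
  (F : (H -> H) -> character R G -> R[i])
  (F_plancherel : plancherel_extension ip m U mu F)
  (s : R) (s_gt0 : 0 < s)
  (gam : character R G -> R)
  (gam_measurable : measurable_fun [set: borel (character R G)] gam)
  (gam_gt0 : forall xi, 0 < gam xi) :
  embedded (sobolev ip mu F s gam) (sobolev_norm mu F s gam)
           (schatten ip 2) (schatten_norm ip 2)
  /\
  (forall T : H -> H, sobolev ip mu F s gam T ->
     schatten_norm ip 2 T <= sobolev_norm mu F s gam T).
Proof.
have norm_le T : sobolev ip mu F s gam T ->
    schatten_norm ip 2 T <= sobolev_norm mu F s gam T.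
  case: F_plancherel => _ _ _ isometry _ [T2 Tfin].
  (* Plancherel, applicable because [T2] puts [T] in the Hilbert-Schmidt class, turns the Schatten
     norm into an [L^2] norm. *)
  by rewrite -isometry// L2norm_le_sobolev_norm// ltW.
split=> //; split=> [T []//|]; exists 1; split=> // T /norm_le.
by rewrite mul1r.
Qed.
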